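(* Let $k\ge 3$ be an integer and let $f$ be one of the functions $\log n$, $\omega(n)$, $\Omega(n)$. Let $\theta_k\ge 1/k$ be any real number such that for every $\varepsilon>0$ $$\sum_{n\le x}\tau_k(n)=x\,P_{k-1}(\log x)+O(x^{\theta_k+\varepsilon}).$$ Then there is a polynomial $P_{f,k-1}(t)$ in $t$ of degree $k-1$ with leading coefficient $\frac{1}{(k-1)!}K_{f,k}$ such that for every $\varepsilon>0$ $$\sum_{n_1\cdots n_k\le x}f((n_1,\ldots,n_k))=x\,P_{f,k-1}(\log x)+O(x^{\theta_k+\varepsilon}),$$ where the sum is over all $(n_1,\ldots,n_k)\in\mathbb{N}^k$ with $n_1\cdots n_k\le x$, and $$K_{\log,k}=\sum_p\frac{\log p}{p^k-1},\qquad K_{\omega,k}=\sum_p\frac{1}{p^k},\qquad K_{\Omega,k}=\sum_p\frac{1}{p^k-1},$$ the sums being over all primes $p$.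
   Context: $\mathbb{N}=\{1,2,\ldots\}$; $(n_1,\ldots,n_k)$ inside $f$ denotes the greatest common divisor of $n_1,\ldots,n_k$. $\omega(n)$ is the number of distinct prime divisors of $n$, and $\Omega(n)$ is the number of prime power divisors $p^\nu$ ($\nu\ge 1$) of $n$, i.e. the number of prime factors of $n$ counted with multiplicity. $\tau_k$ is the $k$-factor Piltz divisor function: $\tau_k(n)$ is the number of $(n_1,\ldots,n_k)\in\mathbb{N}^k$ with $n_1\cdots n_k=n$. $P_{k-1}$ is the polynomial of degree $k-1$, with leading coefficient $1/(k-1)!$, determined by $P_{k-1}(\log x)=\operatorname{Res}_{s=1}\left(\zeta^k(s)\frac{x^{s-1}}{s}\right)$. $O$-estimates are as $x\to\infty$; implied constants may depend on $k$, $\theta_k$, $\varepsilon$ and $f$. *)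

(* Defs.v *)
From HB Require Import structures.
From mathcomp Require Import all_boot all_order all_algebra.
From mathcomp Require Import all_classical all_reals all_analysis.
From mathcomp Require Import complex.

Set Implicit Arguments.
Unset Strict Implicit.
Unset Printing Implicit Defensive.

Import Order.TTheory GRing.Theory Num.Theory numFieldNormedType.Exports.

Local Open Scope classical_set_scope.
Local Open Scope ring_scope.

(* Lets the Landau notation [=O_ F] be used for F = pinfty_nbhs R. *)
Canonical pinfty_filter_on (R : numFieldType) :=
  FilterType (pinfty_nbhs R) (@filter_filter _ _ (@proper_pinfty_nbhs R)).

(* The alias [^o] provides the normed-module structure of the complex numbers
   over themselves, hence complex limits and complex differentiability. *)
Notation Cplx R := (R[i]^o) (only parsing).

Definition cexp (R : realType) (z : Cplx R) : Cplx R :=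
  (expR (complex.Re z))%:C%C * (cos (complex.Im z) +i* sin (complex.Im z))%C.

(* x ^ s for a positive real base x and a complex exponent s *)
Definition cpow (R : realType) (x : R) (s : Cplx R) : Cplx R :=
  cexp (s * (ln x)%:C%C).

(* [zeta] is holomorphic on C \ {1} and is given by the Dirichlet series on
   Re s > 1; its value at 1 is irrelevant. *)
Definition is_riemann_zeta (R : realType) (zeta : Cplx R -> Cplx R) : Prop :=
  (forall s : Cplx R, s != 1 -> derivable zeta s 1) /\
  (forall s : Cplx R, 1 < complex.Re s ->
     series (fun n => cpow (n.+1)%:R (- s)) @ \oo --> zeta s).

(* Residue at a pole (of order at most m + 1): F has near s0 the Laurent
   expansion F s = \sum_n a_n (s - s0)^(n - m - 1), so the coefficient of
   (s - s0)^(-1) is a_m.  Order comparison with [0 <] and [< r] involves only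
   real numbers, since norms in R[i] are real. *)
Definition is_residue (R : realType) (F : Cplx R -> Cplx R) (s0 c : Cplx R)
    : Prop :=
  exists (m : nat) (a : nat -> Cplx R) (r : R),
    [/\ 0 < r,
        forall s : Cplx R, 0 < `|s - s0| -> `|s - s0| < r%:C%C ->
          series (fun n => a n * (s - s0) ^+ n) @ \oo
            --> (s - s0) ^+ m.+1 * F s
      & a m = c].

Definition is_piltz_poly (R : realType) (k : nat) (P : {poly R}) : Prop :=
  [/\ size P = k,
      lead_coef P = (k.-1)`!%:R^-1
    & exists zeta : Cplx R -> Cplx R, is_riemann_zeta zeta /\
        forall x : R, 0 < x ->
          is_residue (fun s => zeta s ^+ k * cpow x (s - 1) / s)
            1 (P.[ln x])%:C%C].

(* Positive factors of m are at most m, so bounding them by m loses nothing. *)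
Definition tau (k m : nat) : nat :=
  #|[set n : {ffun 'I_k -> 'I_m.+1} |
      [forall i, (0 < n i)%N] && ((\prod_(i < k) n i)%N == m)]|.

Definition tau_sum (R : realType) (k : nat) (x : R) : R :=
  \sum_(1 <= m < (Num.truncn x).+1) (tau k m)%:R.

(* Positive integers with product at most x are themselves at most the integer
   part of x, so the index set contains all the tuples of the sum. *)
Definition gcd_sum (R : realType) (f : nat -> R) (k : nat) (x : R) : R :=
  \sum_(n : {ffun 'I_k -> 'I_(Num.truncn x).+1} |
         [forall i, (0 < n i)%N] && ((\prod_(i < k) n i)%N%:R <= x))
    f (\big[gcdn/0%N]_(i < k) n i).

Definition log_fun (R : realType) (n : nat) : R := ln n%:R.

Definition omega (n : nat) : nat := size (primes n).

Definition Omega (n : nat) : nat := (\sum_(p <- primes n) logn p n)%N.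

Definition K_log (R : realType) (k : nat) : R :=
  \big[+%R/0]_(0 <= p <oo | prime p) (ln p%:R / (p%:R ^+ k - 1)).

Definition K_omega (R : realType) (k : nat) : R :=
  \big[+%R/0]_(0 <= p <oo | prime p) (p%:R ^+ k : R)^-1.

Definition K_Omega (R : realType) (k : nat) : R :=
  \big[+%R/0]_(0 <= p <oo | prime p) (p%:R ^+ k - 1 : R)^-1.

(* Main.v *)
(* Write f(n) as the sum of g(d) over d | n; then 0 <= g(d) <= C ln d.  Sorting
   the tuples by the divisors d of their gcd turns the sum into the sum over d
   of g(d) T(x / d^k), where T is the summatory function of tau_k.  Put
   T(y) = y P(ln y) + E(y) for all y > 0, so that E(y) = - y P(ln y) for y < 1.
   The terms x g(d) d^-k P(ln x - k ln d), expanded by Taylor at ln x and summed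
   over all d, give x Pf(ln x) with leading coefficient that of P times the sum
   of g(d) d^-k, which is K.  As E(y) = O(y^tau + y^s) with tau = theta + eps and
   s = min(tau, 1/2), and both k tau and k s exceed 1, the errors g(d) E(x / d^k)
   add up to O(x^tau) even over all d. *)

Require Import Defs.
From HB Require Import structures.
From mathcomp Require Import all_boot all_order all_algebra.
From mathcomp Require Import all_classical all_reals all_analysis.
From mathcomp Require Import complex.
From mathcomp Require Import ring lra.

Set Implicit Arguments.
Unset Strict Implicit.
Unset Printing Implicit Defensive.

Import Order.TTheory GRing.Theory Num.Theory numFieldNormedType.Exports.

Local Open Scope classical_set_scope.
Local Open Scope ring_scope.

(** * Sorting the tuples by the divisors of their gcd *)

Lemma leq_prod_factor (I : finType) (F : I -> nat) (i : I) :
  (forall j, (0 < F j)%N) -> (F i <= \prod_j F j)%N.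
Proof.
by move=> F0; rewrite (bigD1 i)//= leq_pmulr// prodn_gt0.
Qed.

Lemma tauE (k m : nat) :
  tau k m = (\sum_(n : {ffun 'I_k -> 'I_m.+1} |
    [forall i, (0 < n i)%N] && ((\prod_(i < k) n i)%N == m)) 1)%N.
Proof.
rewrite sum1_card; apply: eq_card => n.
by apply/idP/idP; rewrite unfold_in/= /in_mem/= asboolE.
Qed.

(** Dividing every entry by [d] is a bijection onto the tuples counted by [tau k m]. The bound [N]
    does not depend on [m], so that one index set serves all [m] when sums are exchanged. *)
Lemma sum_dvd_tuples (k d m N : nat) : (0 < d)%N -> (d ^ k * m <= N)%N ->
  (\sum_(n : {ffun 'I_k -> 'I_N.+1} |
      [forall i, (0 < n i)%N && (d %| n i)%N] &&
      ((\prod_(i < k) n i)%N == (d ^ k * m)%N)) 1)%N = tau k m.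
Proof.
move=> d0 dmN; rewrite tauE.
pose h (n : {ffun 'I_k -> 'I_m.+1}) : {ffun 'I_k -> 'I_N.+1} :=
  [ffun i => inord (d * n i)].
pose h' (n : {ffun 'I_k -> 'I_N.+1}) : {ffun 'I_k -> 'I_m.+1} :=
  [ffun i => inord (n i %/ d)].
have prodd (F : 'I_k -> nat) :
    (\prod_(i < k) (d * F i) = d ^ k * \prod_(i < k) F i)%N.
  by rewrite big_split /= prod_nat_const card_ord.
have hK (n : {ffun 'I_k -> 'I_m.+1}) : [forall i, (0 < n i)%N] -> (\prod_(i < k) n i)%N = m ->
    forall i, h n i = (d * n i)%N :> nat.
  move=> /forallP n0 nm i; rewrite ffunE inordK// ltnS (leq_trans _ dmN)//.
  rewrite -[X in (_ <= _ * X)%N]nm -prodd.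
  apply: (@leq_prod_factor _ (fun i => d * n i)%N) => j.
  by rewrite muln_gt0 d0 n0.
rewrite (@reindex_onto _ _ _ _ _ h h') /=; last first.
  move=> n /andP[/forallP n0 /eqP nm].
  apply/ffunP => i; apply: val_inj; rewrite /= !ffunE.
  have nd j : (n j = d * (n j %/ d) :> nat)%N.
    by have /andP[_ /divnK] := n0 j; rewrite mulnC.
  have leE : (n i %/ d <= m)%N.
    have -> : m = (\prod_(i < k) (n i %/ d))%N.
      apply/eqP; rewrite -(eqn_pmul2l (_ : 0 < d ^ k)%N) ?expn_gt0 ?d0//.
      by rewrite -nm -prodd; apply/eqP/eq_bigr => j _.
    apply: (@leq_prod_factor _ (fun i => n i %/ d)%N) => j.
    have /andP[+ _] := n0 j; rewrite {1}nd.
    by rewrite muln_gt0 => /andP[].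
  by rewrite (@inordK m)// -nd inord_val.
apply: eq_bigl => n; apply/idP/idP.
  move=> /andP[/andP[/forallP hn0 /eqP hnm] _].
  (* Out of range [inord] returns 0, which positivity of the entry excludes. *)
  have hnE i : h n i = (d * n i)%N :> nat.
    have /andP[+ _] := hn0 i; rewrite ffunE /inord /insubd.
    by case: insubP => [u _ -> //|].
  apply/andP; split.
    apply/forallP => i; have /andP[+ _] := hn0 i.
    by rewrite hnE muln_gt0 => /andP[].
  rewrite -(eqn_pmul2l (_ : 0 < d ^ k)%N) ?expn_gt0 ?d0//.
  by rewrite -prodd -hnm; apply/eqP/eq_bigr => i _; rewrite hnE.
move=> /andP[n0 /eqP nm]; have hE := hK _ n0 nm; move/forallP: n0 => n0.
apply/andP; split; first apply/andP; first split.
- by apply/forallP => i; rewrite hE muln_gt0 d0 n0 dvdn_mulr.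
- rewrite -[X in (_ == _ * X)%N]nm -prodd; apply/eqP/eq_bigr => i _; exact: hE.
- apply/eqP/ffunP => i; apply: val_inj.
  by rewrite /= ffunE hE mulKn// inord_val.
Qed.

Lemma tau_sum_dvd_tuples (R : realType) (k d : nat) (x : R) :
  (0 < d)%N -> 0 <= x ->
  tau_sum k (x / d%:R ^+ k) =
  \sum_(n : {ffun 'I_k -> 'I_(Num.truncn x).+1} |
      [forall i, (0 < n i)%N && (d %| n i)%N] &&
      ((\prod_(i < k) n i)%N%:R <= x)) 1.
Proof.
move=> d0 x0; have dk0 : 0 < d%:R ^+ k :> R by rewrite exprn_gt0// ltr0n.
have y0 : 0 <= x / d%:R ^+ k by rewrite divr_ge0// ltW.
rewrite /tau_sum.
under eq_big_nat => m /andP[_ mx].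
  rewrite -(@sum_dvd_tuples k d m (Num.truncn x) d0); last first.
    rewrite truncn_ge_nat// natrM natrX mulrC -ler_pdivlMr//.
    by rewrite -truncn_ge_nat.
  rewrite natr_sum big_mkcond /=.
  over.
rewrite exchange_big /= [RHS]big_mkcond /=. apply: eq_bigr => n _.
rewrite -big_mkcond /=.
have [/forallP Pn|_] := boolP [forall i, (0 < n i)%N && (d %| n i)%N];
  last by rewrite big_pred0.
have n0 : (0 < \prod_(i < k) n i)%N.
  by rewrite prodn_gt0// => i; have /andP[] := Pn i.
have nE : (\prod_(i < k) n i = d ^ k * \prod_(i < k) (n i %/ d))%N.
  rewrite -[X in (_ ^ X)%N]card_ord -prod_nat_const -big_split /=.
  by apply: eq_bigr => i _; have /andP[_ /divnK] := Pn i; rewrite mulnC.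
rewrite nE in n0 *; move: n0; rewrite muln_gt0 => /andP[dk0' m0].
(* Only one [m] survives in the inner sum: the product of the quotients n_i / d. *)
under eq_bigl do rewrite /= eqn_pmul2l// eq_sym.
rewrite big_nat1_eq m0 ltnS truncn_ge_nat// ler_pdivlMr//.
by rewrite natrM natrX mulrC.
Qed.

(** The gcd divides an entry, hence is at most [Num.truncn x]. The bound [M] is left free so that it
    can later tend to infinity with [x] fixed. *)
Lemma gcd_sumE (R : realType) (f g : nat -> R) (k M : nat) (x : R) :
  (0 < k)%N -> 0 <= x -> (Num.truncn x <= M)%N ->
  (forall n, (0 < n)%N -> f n = \sum_(1 <= d < n.+1 | (d %| n)%N) g d) ->
  gcd_sum f k x = \sum_(1 <= d < M.+1) g d * tau_sum k (x / d%:R ^+ k).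
Proof.
move=> k0 x0 xM fg; rewrite /gcd_sum.
transitivity (\sum_(n : {ffun 'I_k -> 'I_(Num.truncn x).+1} |
    [forall i, (0 < n i)%N] && ((\prod_(i < k) n i)%N%:R <= x))
    \sum_(1 <= d < M.+1) if (d %| \big[gcdn/0%N]_(i < k) n i)%N then g d else 0).
  apply: eq_bigr => n /andP[/forallP n0 _].
  set G := \big[gcdn/0%N]_(i < k) n i.
  have Gn : (G %| n (Ordinal k0))%N by apply: biggcdn_inf.
  have G0 : (0 < G)%N by exact: dvdn_gt0 Gn.
  have GM : (G <= M)%N.
    apply: leq_trans xM; apply: (leq_trans (dvdn_leq _ Gn)) => //.
    by rewrite -ltnS.
  rewrite fg// -big_mkcond /= [RHS](@big_cat_nat _ _ _ G.+1)//=.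
  rewrite [X in _ = _ + X]big_nat_cond [X in _ = _ + X]big1 ?addr0//.
  by move=> d /andP[/andP[Gd _] /(dvdn_leq G0)]; rewrite leqNgt Gd.
rewrite exchange_big /=; apply: eq_big_nat => d /andP[d0 _].
rewrite tau_sum_dvd_tuples// mulr_sumr -big_mkcondr /=.
apply: eq_big => [n|n _]; last by rewrite mulr1.
rewrite -andbA [X in _ && X]andbC andbA; congr (_ && _).
apply/andP/forallP => [[/forallP n0 /dvdn_biggcdP dn] i|n0].
  by rewrite n0 dn.
split; first by apply/forallP => i; have /andP[] := n0 i.
by apply/dvdn_biggcdP => i _; have /andP[] := n0 i.
Qed.

(** * Growth bounds and the error term for all positive arguments *)

Lemma tau_sum_lt1 (R : realType) (k : nat) (x : R) : x < 1 -> tau_sum k x = 0.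
Proof.
by move=> x1; rewrite /tau_sum (truncn0Pn _ _) ?big_geq// -ltNge.
Qed.

Lemma tau_sum_ge0 (R : realType) (k : nat) (x : R) : 0 <= tau_sum k x.
Proof. by apply: sumr_ge0. Qed.

Lemma le_tau_sum (R : realType) (k : nat) : {homo @tau_sum R k : x y / x <= y}.
Proof.
move=> x y /le_truncn xy; rewrite /tau_sum.
by rewrite [leRHS](@big_cat_nat _ _ _ (Num.truncn x).+1)//= lerDl sumr_ge0.
Qed.

(** Applied at t = ln x, this bounds a polynomial in the logarithm by a small power of x. In the
    induction, half of [delta] serves the smaller polynomial and the other half absorbs the factor
    t, because u <= e^u. *)
Lemma horner_le_expR (R : realType) (P : {poly R}) (delta : R) : 0 < delta ->
  exists2 C, 0 <= C & forall t, `|P.[t]| <= C * expR (delta * `|t|).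
Proof.
elim/poly_ind: P delta => [|P c IH] delta delta0.
  by exists 0 => // t; rewrite horner0 normr0 mul0r.
have d20 : 0 < delta / 2 by lra.
have [C C0 HC] := IH _ d20.
exists (C * (delta / 2)^-1 + `|c|); first by rewrite addr_ge0 ?mulr_ge0 ?invr_ge0// ltW.
move=> t; rewrite !hornerE (le_trans (ler_normD _ _))// mulrDl lerD//; last first.
  by rewrite ler_peMr// -expR0 ler_expR mulr_ge0// ltW.
rewrite normrM (_ : expR _ = expR (delta / 2 * `|t|) * expR (delta / 2 * `|t|)); last first.
  by rewrite -expRD; congr expR; lra.
rewrite mulrACA ler_pM// mulrC ler_pdivlMr// mulrC.
by apply: le_trans (expR_ge1Dx _); rewrite lerDr.
Qed.

Lemma sum_powR_le (R : realType) (a : R) (M : nat) : 0 < a ->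
  \sum_(1 <= d < M.+1) d%:R `^ (- (1 + a)) <= 1 + a^-1.
Proof.
(* The terms telescope: a n^(-1-a) <= (n - 1)^-a - n^-a. *)
move=> a0; have a0' : 0 <= a^-1 by rewrite invr_ge0 ltW.
case: M => [|M]; first by rewrite big_geq// addr_ge0.
suff : \sum_(1 <= d < M.+2) d%:R `^ (- (1 + a)) <=
       1 + a^-1 - a^-1 * M.+1%:R `^ (- a).
  move=> /le_trans; apply; rewrite gerBl mulr_ge0// powR_ge0.
elim: M => [|M IH]; first by rewrite big_nat1 !powR1; lra.
rewrite big_nat_recr//= (le_trans (lerD IH (lexx _)))//.
set m : R := M.+1%:R; set n : R := M.+2%:R.
have nE : n = m + 1 by rewrite /n /m -natr1.
have m0 : 0 < m by rewrite ltr0n.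
have n0 : 0 < n by rewrite ltr0n.
clearbody m n.
suff H : n `^ (- a) * (1 + a / n) <= m `^ (- a).
  have -> : n `^ (- (1 + a)) = n `^ (- a) / n.
    rewrite opprD addrC powRD ?powR_inv1 ?ltW//.
    by apply/implyP => _; rewrite gt_eqF.
  have {}H : a^-1 * (n `^ (- a) * (1 + a / n)) <= a^-1 * m `^ (- a).
    by rewrite ler_wpM2l.
  have E : a^-1 * (n `^ (- a) * (1 + a / n)) =
           a^-1 * n `^ (- a) + n `^ (- a) / n.
    by field; rewrite !gt_eqF.
  by rewrite E in H; lra.
(* Use 1 + u <= e^u at u = a / n; then a / n <= a (ln n - ln m), because m / n = 1 - 1 / n and ln (1
   - 1 / n) <= - 1 / n. *)
apply: (@le_trans _ _ (n `^ (- a) * expR (a / n))).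
  by rewrite ler_wpM2l ?powR_ge0 ?expR_ge1Dx.
rewrite /powR !gt_eqF// -expRD ler_expR.
have : ln (m / n) <= - n^-1.
  have -> : m / n = 1 + - n^-1 by rewrite nE; field; rewrite -nE gt_eqF.
  apply: le_ln1Dx; rewrite ltrN2 invf_lt1// nE ltrDr//.
rewrite ln_div ?posrE// => H.
have : a * (ln m - ln n) <= a * - n^-1 by rewrite ler_pM2l.
lra.
Qed.

Lemma sum_log_growth_le (R : realType) (g : nat -> R) (C a : R) (j : nat) :
  (forall d, (0 < d)%N -> 0 <= g d <= C * ln d%:R) -> 1 < a ->
  exists B, forall M,
    \sum_(1 <= d < M.+1) g d * ln d%:R ^+ j * d%:R `^ (- a) <= B.
Proof.
move=> gC a1.
have C0 : 0 <= C.
  have /andP[g0 gle] := gC 2%N isT.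
  by have := le_trans g0 gle; rewrite pmulr_lge0// ln_gt0// ltr1n.
(* The powers of the logarithm cost d^delta, which leaves the exponent - (a - delta) = - (1 +
   delta), still summable. *)
pose delta := (a - 1) / 2.
have delta0 : 0 < delta by rewrite /delta; lra.
have [D D0 HD] := horner_le_expR ('X^(j.+1) : {poly R}) delta0.
exists (C * D * (1 + delta^-1)) => M.
apply: (@le_trans _ _ (\sum_(1 <= d < M.+1) C * D * d%:R `^ (- (1 + delta)))).
  apply: ler_sum_nat => d /andP[d0 _].
  have dR0 : 0 < d%:R :> R by rewrite ltr0n.
  have lnd : 0 <= ln d%:R :> R by rewrite ln_ge0// ler1n.
  have := HD (ln d%:R); rewrite hornerXn !ger0_norm ?exprn_ge0// => HDd.
  apply: (@le_trans _ _ (C * ln d%:R * ln d%:R ^+ j * d%:R `^ (- a))).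
    rewrite ler_wpM2r ?powR_ge0// ler_wpM2r ?exprn_ge0//.
    by have /andP[] := gC d d0.
  rewrite -mulrA -!mulrA ler_wpM2l// mulrA -exprS.
  apply: (@le_trans _ _ (D * expR (delta * ln d%:R) * d%:R `^ (- a))).
    by rewrite ler_wpM2r ?powR_ge0.
  rewrite /powR gt_eqF// -mulrA -expRD ler_wpM2l// ler_expR.
  rewrite le_eqVlt; apply/orP; left; apply/eqP; rewrite /delta; lra.
by rewrite -mulr_sumr ler_wpM2l ?mulr_ge0// sum_powR_le.
Qed.

(* The term [x `^ s] covers the range [x < 1], where the left-hand side is
   [x * P.[ln x]] up to sign. *)
Lemma piltz_error_le (R : realType) (k : nat) (P : {poly R}) (tau s : R) :
  0 < tau -> 0 < s <= 2^-1 ->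
  (fun x : R => tau_sum k x - x * P.[ln x])
    =O_ (pinfty_nbhs R) (fun x : R => x `^ tau) ->
  exists2 C, 0 <= C & forall x, 0 < x ->
    `|tau_sum k x - x * P.[ln x]| <= C * (x `^ tau + x `^ s).
Proof.
move=> tau0 /andP[s0 s12] /eqO_exP[c c0 [Y [_ HY]]].
have half0 : 0 < 2^-1 :> R by lra.
have [D D0 HD] := horner_le_expR P half0.
pose Z := Num.max Y 1; have Z1 : 1 <= Z by rewrite le_max lexx orbT.
have Z0 : 0 < Z by lra.
(* [B] bounds the error on [1, Z], both of its terms being monotone there; powers of x are at least
   1 on that range. *)
pose B := tau_sum k Z + Z * (D * expR (2^-1 * ln Z)).
have TZ0 := tau_sum_ge0 k Z.
have B0 : 0 <= B.
  by rewrite addr_ge0// mulr_ge0// ?mulr_ge0 ?expR_ge0// ltW.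
have c0' := ltW c0.
exists (c + B + D) => [|x x0]; first by apply: addr_ge0 => //; exact: addr_ge0.
have xtau : 0 <= x `^ tau by exact: powR_ge0.
have xs : 0 <= x `^ s by exact: powR_ge0.
have [? ?] := (mulr_ge0 c0' xtau, mulr_ge0 c0' xs).
have [? ?] := (mulr_ge0 B0 xtau, mulr_ge0 B0 xs).
have [? ?] := (mulr_ge0 D0 xtau, mulr_ge0 D0 xs).
suff : [\/ `|tau_sum k x - x * P.[ln x]| <= c * x `^ tau,
          `|tau_sum k x - x * P.[ln x]| <= B * x `^ tau |
          `|tau_sum k x - x * P.[ln x]| <= D * x `^ s].
  by case; lra.
have [xlt1|x1] := ltP x 1.
  (* For x < 1 the bound on P gives |x P(ln x)| <= D x x^(-1/2) = D x^(1/2), and this is at most D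
     x^s as s <= 1/2. *)
  apply: Or33; rewrite tau_sum_lt1// sub0r normrN normrM gtr0_norm//.
  rewrite (le_trans (ler_wpM2l (ltW x0) (HD _)))// mulrCA ler_wpM2l//.
  have lnx : ln x < 0 by rewrite ln_lt0// x0.
  rewrite -{1}[x]lnK ?posrE// -expRD /powR gt_eqF// ler_expR ltr0_norm//.
  have : (2^-1 - s) * ln x <= 0 by apply: mulr_ge0_le0; lra.
  lra.
have [xY|Yx] := leP x Y; last first.
  by apply: Or31; rewrite (le_trans (HY _ Yx))// ger0_norm// powR_ge0.
apply: Or32.
have xZ : x <= Z by rewrite le_max xY.
apply: (@le_trans _ _ (B * 1)); last first.
  by rewrite ler_wpM2l// -(powRr0 x) ler_powR// ltW.
rewrite mulr1 (le_trans (ler_normB _ _))// lerD//.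
  by rewrite ger0_norm ?tau_sum_ge0// le_tau_sum.
rewrite normrM (ger0_norm (ltW x0)) ler_pM// ?(ltW x0)//.
rewrite (le_trans (HD _))// ler_wpM2l// ler_expR ger0_norm ?ln_ge0//.
by rewrite ler_wpM2l ?(ltW half0)// ler_ln ?posrE.
Qed.

(** * Main term and error for a general divisor sum *)

(** Differentiation lowers the degree, so only j = 0 contributes to the coefficient of degree k -
    1. *)
Lemma nderivn_comb_lead (R : numFieldType) (k : nat) (P : {poly R})
    (b : nat -> R) : (0 < k)%N -> size P = k -> b 0%N != 0 ->
  let Q := \sum_(j < k) b j *: P^`N(j) in
  size Q = k /\ lead_coef Q = b 0%N * lead_coef P.
Proof.
case: k => // k _ sP b0 Q.
have Qcoef i : Q`_i = \sum_(j < k.+1) b j * (P`_(j + i) *+ 'C(j + i, j)).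
  by rewrite coef_sum; apply: eq_bigr => j _; rewrite coefZ coef_nderivn.
have Qk : Q`_k = b 0%N * lead_coef P.
  rewrite Qcoef big_ord_recl add0n bin0 mulr1n big1 ?addr0.
    by rewrite lead_coefE sP.
  by move=> j _; rewrite nth_default ?mul0rn ?mulr0// sP ltnS leq_addl.
have sQ : size Q = k.+1.
  apply/eqP; rewrite eqn_leq; apply/andP; split.
    apply/leq_sizeP => i ki; rewrite Qcoef big1// => j _.
    by rewrite nth_default ?mul0rn ?mulr0// sP (leq_trans ki)// leq_addl.
  rewrite ltnNge; apply/negP => /leq_sizeP/(_ k (leqnn _)).
  rewrite Qk => /eqP; rewrite mulf_eq0 (negbTE b0)/= lead_coef_eq0.
  by rewrite -size_poly_eq0 sP.
by split=> //; rewrite lead_coefE sQ.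
Qed.

(** The function f enters only through [g], whose logarithmic growth makes all sums of g(d) (ln d)^j
    d^(-a) with a > 1 converge. The condition [K != 0] fixes the degree of [Pf]. *)
Lemma gcd_sum_asymptotics (R : realType) (k : nat) (f g : nat -> R) (C K : R)
    (P : {poly R}) (theta : R) :
  (3 <= k)%N -> size P = k -> k%:R^-1 <= theta ->
  (forall n, (0 < n)%N -> f n = \sum_(1 <= d < n.+1 | (d %| n)%N) g d) ->
  (forall d, (0 < d)%N -> 0 <= g d <= C * ln d%:R) ->
  (fun M => \sum_(1 <= d < M.+1) g d / d%:R ^+ k) @ \oo --> K -> K != 0 ->
  (forall eps : R, 0 < eps ->
    (fun x : R => tau_sum k x - x * P.[ln x])
      =O_ (pinfty_nbhs R) (fun x : R => x `^ (theta + eps))) ->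
  exists Pf : {poly R},
    [/\ size Pf = k,
        lead_coef Pf = lead_coef P * K
      & forall eps : R, 0 < eps ->
          (fun x : R => gcd_sum f k x - x * Pf.[ln x])
            =O_ (pinfty_nbhs R) (fun x : R => x `^ (theta + eps))].
Proof.
move=> k3 sP thk fg gC gK K0 hO.
have k0 : (0 < k)%N by apply: leq_trans k3.
have kR3 : 3 <= k%:R :> R by rewrite (ler_nat _ 3).
have kR0 : 0 < k%:R :> R by lra.
pose a j M := \sum_(1 <= d < M.+1) g d * ln d%:R ^+ j * d%:R `^ (- k%:R).
have acvg j : a j @ \oo --> limn (a j).
  apply: nondecreasing_is_cvgn.
    move=> m n mn; apply: nondecreasing_series => // d d0 _.
    rewrite mulr_ge0 ?powR_ge0// mulr_ge0 ?exprn_ge0 ?ln_ge0 ?ler1n//.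
    by have /andP[] := gC d d0.
  have [|B HB] := sum_log_growth_le (a := k%:R) j gC; first by lra.
  by exists B => _ [M _ <-]; exact: HB.
have a0K : limn (a 0%N) = K.
  apply/cvg_lim => //; apply: cvg_trans gK; apply: near_eq_cvg.
  apply: nearW => M; apply: eq_bigr => d _.
  by rewrite mulr1 powR_invn.
(* Taylor expansion of P(L - k ln d) at L yields (- k ln d)^j times the j-th derivative over j!.
   Summing over d turns (ln d)^j into [c j], either a partial sum [a j M] or its limit. *)
pose Q (c : nat -> R) := \sum_(j < k) ((- k%:R) ^+ j * c j) *: P^`N(j).
have QE c L : (Q c).[L] = \sum_(j < k) P^`N(j).[L] * (- k%:R) ^+ j * c j.
  by rewrite horner_sum; apply: eq_bigr => j _; rewrite hornerZ mulrC mulrA.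
exists (Q (fun j => limn (a j))).
have [|sQ lQ] := @nderivn_comb_lead R k P (fun j => (- k%:R) ^+ j * limn (a j)) k0 sP.
  by rewrite expr0 mul1r a0K.
split=> //; first by rewrite lQ a0K expr0 mul1r mulrC.
move=> eps eps0; set tau := theta + eps.
have ktau : 1 < k%:R * tau.
  have : k%:R * k%:R^-1 <= k%:R * theta by rewrite ler_pM2l.
  by rewrite mulfV ?gt_eqF// mulrDr => ?; have := mulr_gt0 kR0 eps0; lra.
have tau0 : 0 < tau by rewrite -(pmulr_rgt0 _ kR0); lra.
pose s := Num.min tau 2^-1.
have ks : 1 < k%:R * s.
  (* If s = 1/2, then k s > 1 because k >= 3. *)
  rewrite /s; case: (leP tau 2^-1) => // _; lra.
have s0 : 0 < s by rewrite -(pmulr_rgt0 _ kR0); lra.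
have s12 : 0 < s <= 2^-1 by rewrite s0 ge_min lexx orbT.
have stau : s <= tau by rewrite ge_min lexx.
have [D D0 HD] := piltz_error_le tau0 s12 (hO _ eps0).
have [B1 HB1] := sum_log_growth_le 0 gC ktau.
have [B2 HB2] := sum_log_growth_le 0 gC ks.
have B10 : 0 <= B1 by have := HB1 0%N; rewrite big_geq.
have B20 : 0 <= B2 by have := HB2 0%N; rewrite big_geq.
(* The added 1 only makes the constant positive. *)
apply/eqO_exP; exists (D * (B1 + B2) + 1).
  by rewrite ltr_wpDl// mulr_ge0// addr_ge0.
exists 1; split=> [|x x1]; first exact: real1.
have x0 : 0 < x by lra.
have xtau : 0 <= x `^ tau := powR_ge0 _ _.
rewrite [X in _ <= _ * X]ger0_norm//.
apply: (@le_trans _ _ (D * (B1 + B2) * x `^ tau)); last first.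
  by rewrite ler_wpM2r// lerDl.
set L := ln x.
(* With x fixed, it suffices to bound the error for the truncated coefficients, uniformly in M >=
   [Num.truncn x], and let M tend to infinity. *)
have cvgQ : (fun M => `|gcd_sum f k x - x * (Q (a ^~ M)).[L]|) @ \oo -->
    `|gcd_sum f k x - x * (Q (fun j => limn (a j))).[L]|.
  apply: cvg_norm; apply: cvgB; first exact: cvg_cst.
  apply: cvgMl_tmp; rewrite QE.
  under eq_fun do rewrite QE.
  apply: cvg_big => [|j _]; first exact: add_continuous.
  by apply: cvgMl_tmp; exact: acvg.
apply: (ler_cvg_to cvgQ (cvg_cst _)).
exists (Num.truncn x) => // M /= xM.
have QxE : x * (Q (a ^~ M)).[L] =
    \sum_(1 <= d < M.+1) g d * (x / d%:R ^+ k * P.[ln (x / d%:R ^+ k)]).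
  transitivity (\sum_(1 <= d < M.+1) \sum_(j < k) x * (P^`N(j).[L] *
      (- k%:R) ^+ j * (g d * ln d%:R ^+ j * d%:R `^ (- k%:R)))).
    rewrite QE mulr_sumr exchange_big /=; apply: eq_bigr => j _.
    by rewrite /a !mulr_sumr.
  apply: eq_big_nat => d /andP[d0 _].
  have dR0 : 0 < d%:R :> R by rewrite ltr0n.
  have -> : ln (x / d%:R ^+ k) = L + - k%:R * ln d%:R.
    by rewrite ln_div ?posrE ?exprn_gt0// lnXn// mulNr mulr_natl.
  rewrite (@nderiv_taylor_wide _ k) ?sP//; last exact: mulrC.
  rewrite !mulr_sumr; apply: eq_bigr => j _.
  by rewrite powR_invn ?ltW// exprMn; ring.
rewrite (gcd_sumE k0 (ltW x0) xM fg) QxE -sumrB.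
apply: (le_trans (ler_norm_sum _ _ _)).
apply: (@le_trans _ _ (\sum_(1 <= d < M.+1) D *
   (x `^ tau * (g d * ln d%:R ^+ 0 * d%:R `^ (- (k%:R * tau))) +
    x `^ s * (g d * ln d%:R ^+ 0 * d%:R `^ (- (k%:R * s)))))).
  apply: ler_sum_nat => d /andP[d0 _].
  have dR0 : 0 < d%:R :> R by rewrite ltr0n.
  have /andP[g0 _] := gC d d0.
  rewrite -mulrBr normrM (ger0_norm g0).
  have y0 : 0 < x / d%:R ^+ k by rewrite divr_gt0// exprn_gt0.
  apply: (le_trans (ler_wpM2l g0 (HD _ y0))).
  have yE r : (x / d%:R ^+ k) `^ r = x `^ r * d%:R `^ (- (k%:R * r)).
    rewrite powRM ?invr_ge0 ?exprn_ge0 ?ltW//; congr (_ * _).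
    by rewrite -powR_invn ?ltW// -powRrM mulNr.
  by rewrite !yE expr0 le_eqVlt; apply/orP; left; apply/eqP; ring.
(* The two sums over d are at most [B1] and [B2], and x^s <= x^tau as x >= 1. *)
rewrite -mulr_sumr -mulrA ler_wpM2l// big_split /= -!mulr_sumr mulrDl.
rewrite (mulrC B1) (mulrC B2) lerD// ?ler_wpM2l// ler_pM ?powR_ge0//.
  rewrite big_nat_cond; apply: sumr_ge0 => d /andP[/andP[d0 _] _].
  have /andP[g0 _] := gC d d0.
  by rewrite mulr_ge0 ?powR_ge0// mulr_ge0// exprn_ge0// ln_ge0// ler1n.
by rewrite ler_powR// ltW.
Qed.

(** * Convergence and positivity of the series for K *)

Lemma dirichlet_cvg (R : realType) (k : nat) (g : nat -> R) (C : R) :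
  (1 < k)%N -> (forall d, (0 < d)%N -> 0 <= g d <= C * ln d%:R) ->
  cvgn (fun M => \sum_(1 <= d < M.+1) g d / d%:R ^+ k).
Proof.
move=> k1 gC; apply: nondecreasing_is_cvgn.
  move=> m n mn; apply: nondecreasing_series => // d d0 _.
  by rewrite divr_ge0 ?exprn_ge0//; have /andP[] := gC d d0.
have [|B HB] := sum_log_growth_le (a := k%:R) 0 gC; first by rewrite ltr1n.
exists B => _ [M _ <-]; apply: le_trans (HB M).
rewrite le_eqVlt; apply/orP; left; apply/eqP/eq_bigr => d _.
by rewrite mulr1 powR_invn.
Qed.

Lemma dirichlet_gt0 (R : realType) (k d0 : nat) (g : nat -> R) (K : R) :
  (forall d, (0 < d)%N -> 0 <= g d) -> (0 < d0)%N -> 0 < g d0 ->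
  (fun M => \sum_(1 <= d < M.+1) g d / d%:R ^+ k) @ \oo --> K -> 0 < K.
Proof.
move=> g0 d00 gd0 gK.
have term_ge0 d : (0 < d)%N -> 0 <= g d / d%:R ^+ k.
  by move=> dgt0; rewrite divr_ge0 ?exprn_ge0 ?g0.
apply: (@lt_le_trans _ _ (g d0 / d0%:R ^+ k)).
  by rewrite divr_gt0// exprn_gt0// ltr0n.
apply: (ler_cvg_to (cvg_cst _) gK); exists d0 => // M /= dM.
rewrite (@big_cat_nat _ _ _ d0)//=; last exact: leqW.
rewrite [X in _ + X]big_ltn ?ltnS// addrCA lerDl addr_ge0//;
  rewrite big_nat_cond sumr_ge0// => d /andP[/andP[d1 _] _]; apply: term_ge0 => //.
exact: leq_trans d1.
Qed.

(** * Functions supported on prime powers *)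

Lemma sum_prime_dvd (V : nmodType) (F : nat -> V) (n : nat) : (0 < n)%N ->
  \sum_(1 <= p < n.+1 | prime p && (p %| n)%N) F p = \sum_(p <- primes n) F p.
Proof.
move=> n0; rewrite -big_filter; apply: perm_big; apply: uniq_perm.
- by rewrite filter_uniq// iota_uniq.
- exact: primes_uniq.
move=> p; rewrite mem_filter mem_index_iota mem_primes n0 -andbA /=.
have [pp|//] := boolP (prime p); rewrite /= prime_gt0//= ltnS.
by case: (boolP (p %| n)%N) => [/(dvdn_leq n0)->|].
Qed.

(** If p^j = d with j >= 1, then p and j are at most d. Raising both bounds to a common [M] makes
    them independent of d, so that the sum over d can be moved inside. *)
Lemma sum_prime_powers (R : realType) (w : nat -> R) (d M : nat) :
  (0 < d <= M)%N ->
  \sum_(1 <= p < d.+1 | prime p) \sum_(1 <= j < d.+1 | (p ^ j == d)%N) w p =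
  \sum_(1 <= p < M.+1 | prime p) \sum_(1 <= j < M.+1 | (p ^ j == d)%N) w p.
Proof.
move=> /andP[d0 dM].
have large p j : prime p -> (0 < j)%N -> (d < p)%N || (d < j)%N ->
    (p ^ j == d)%N = false.
  move=> pp j0 dlt; apply/negP => /eqP E; move: dlt; rewrite -E.
  rewrite ltnNge -{1}(expn1 p) leq_exp2l ?prime_gt1// j0 /=.
  by rewrite ltnNge ltnW// ltn_expl// prime_gt1.
rewrite [RHS](@big_cat_nat _ _ _ d.+1)//= [X in _ + X]big_nat_cond.
rewrite [X in _ + X]big1 ?addr0; last first.
  move=> p /andP[/andP[dp _] pp]; rewrite big_nat_cond big_pred0// => j.
  by apply/negP => /andP[/andP[j1 _]]; rewrite large// dp.
apply: eq_bigr => p pp; rewrite [RHS](@big_cat_nat _ _ _ d.+1)//=.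
rewrite [X in _ + X]big_nat_cond [X in _ + X]big_pred0 ?addr0// => j.
apply/negP => /andP[/andP[dj _]]; rewrite large ?dj ?orbT//.
exact: leq_trans dj.
Qed.

Lemma sum_geometric (F : fieldType) (q : F) (J : nat) : q != 0 -> q != 1 ->
  \sum_(1 <= j < J.+1) q ^- j = (1 - q ^- J) / (q - 1).
Proof.
move=> q0 q1; have q10 : q - 1 != 0 by rewrite subr_eq0.
elim: J => [|J IH]; first by rewrite big_geq// expr0 invr1 subrr mul0r.
rewrite big_nat_recr//= IH exprS.
by field; rewrite q10 q0 expf_neq0.
Qed.

(* Equals the von Mangoldt function when [w p] is [ln p]. *)
Definition prime_power_weight (R : realType) (w : nat -> R) (d : nat) : R :=
  \sum_(1 <= p < d.+1 | prime p) \sum_(1 <= j < d.+1 | (p ^ j == d)%N) w p.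

Lemma sum_prime_power_weight (R : realType) (w h : nat -> R) (M : nat) :
  \sum_(1 <= d < M.+1) prime_power_weight w d * h d =
  \sum_(1 <= p < M.+1 | prime p)
    w p * \sum_(1 <= j < M.+1 | (p ^ j <= M)%N) h (p ^ j)%N.
Proof.
transitivity (\sum_(1 <= d < M.+1) \sum_(1 <= p < M.+1 | prime p)
    \sum_(1 <= j < M.+1) if (d == p ^ j)%N then w p * h d else 0).
  apply: eq_big_nat => d; rewrite ltnS => dM.
  rewrite /prime_power_weight (sum_prime_powers w dM) mulr_suml.
  apply: eq_bigr => p _; rewrite mulr_suml big_mkcond /=.
  by apply: eq_bigr => j _; rewrite eq_sym.
rewrite exchange_big /=; apply: eq_bigr => p pp.
rewrite exchange_big /= mulr_sumr [RHS]big_mkcond /=; apply: eq_bigr => j _.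
rewrite -big_mkcond big_nat1_eq ltnS expn_gt0 prime_gt0//.
Qed.

(** With h the indicator of the divisors of n, the sum over j counts the j >= 1 such that p^j
    divides n, which is the p-adic valuation of n. *)
Lemma sum_dvd_prime_power_weight (R : realType) (w : nat -> R) (n : nat) :
  (0 < n)%N ->
  \sum_(1 <= d < n.+1 | (d %| n)%N) prime_power_weight w d =
  \sum_(p <- primes n) (logn p n)%:R * w p.
Proof.
move=> n0; rewrite -sum_prime_dvd// [RHS]big_mkcondr /= big_mkcond /=.
under eq_bigr do rewrite -mulrb -mulr_natr.
rewrite (sum_prime_power_weight w (fun d => (d %| n)%N%:R)).
apply: eq_bigr => p pp.
have -> : \sum_(1 <= j < n.+1 | (p ^ j <= n)%N) (p ^ j %| n)%N%:R =
          (logn p n)%:R :> R.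
  rewrite [in RHS](_ : logn p n = \sum_(1 <= j < (logn p n).+1) 1)%N; last first.
    by rewrite sum_nat_const_nat subn1 muln1.
  rewrite natr_sum (@big_cat_nat _ _ _ (logn p n).+1)//=; last first.
    by rewrite ltnS ltnW// ltn_logl.
  rewrite [X in _ + X]big_nat_cond [X in _ + X]big1 ?addr0; last first.
    by move=> j /andP[/andP[jl _] _]; rewrite pfactor_dvdn// leqNgt jl.
  rewrite big_mkcond /=; apply: eq_big_nat => j /andP[_ jl].
  have pjn : (p ^ j %| n)%N by rewrite pfactor_dvdn.
  by rewrite pjn (dvdn_leq n0 pjn).
rewrite mulrC; case: (boolP (p %| n)%N) => // pn.
by rewrite lognE pp n0 (negbTE pn) mul0r.
Qed.

Lemma ln_prime_decomp (R : realType) (n : nat) : (0 < n)%N ->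
  \sum_(p <- primes n) (logn p n)%:R * ln p%:R = ln n%:R :> R.
Proof.
move=> n0; rewrite {3}(prod_prime_decomp n0) prime_decompE big_map /=.
rewrite natr_prod big_seq [in RHS]big_seq.
(* Positivity is carried through the induction because [lnM] needs positive factors. *)
suff [] : 0 < \prod_(p <- primes n | p \in primes n) (p ^ logn p n)%:R :> R /\
  \sum_(p <- primes n | p \in primes n) (logn p n)%:R * ln p%:R =
  ln (\prod_(p <- primes n | p \in primes n) (p ^ logn p n)%:R) :> R by [].
elim/big_rec2: _ => [|p y1 y2 pn [y0 ->]]; first by rewrite ln1.
have p0 : 0 < p%:R :> R.
  by rewrite ltr0n prime_gt0//; move: pn; rewrite mem_primes => /andP[].
have pl0 : 0 < (p ^ logn p n)%:R :> R by rewrite natrX exprn_gt0.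
split; first exact: mulr_gt0.
by rewrite lnM ?posrE// natrX lnXn// mulr_natl.
Qed.

(** With q = p^k and J the largest exponent such that p^J <= M, the difference is the geometric tail
    q^(-J-1) q / (q - 1). Here q / (q - 1) <= 2, and p^(J+1) > M. *)
Lemma prime_power_series_diff (R : realType) (k p M : nat) :
  (3 <= k)%N -> prime p -> (0 < M)%N ->
  0 <= (p%:R ^+ k - 1 : R)^-1 -
       \sum_(1 <= j < M.+1 | (p ^ j <= M)%N) (p ^ j)%:R ^- k <=
       2 * M%:R ^- k.
Proof.
move=> k3 pp M0; have [p0 p1] := (prime_gt0 pp, prime_gt1 pp).
have p2 : 2 <= p%:R :> R by rewrite (ler_nat _ 2).
set q : R := p%:R ^+ k.
have q2 : 2 <= q.
  apply: le_trans p2 _; rewrite /q -[X in X <= _]expr1 ler_eXn2l ?ltr1n//.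
  exact: leq_trans k3.
set J := trunc_log p M.
have JM : (J <= M)%N.
  apply: ltnW; apply: leq_trans (ltn_expl J p1) _.
  by rewrite trunc_logP.
have -> : \sum_(1 <= j < M.+1 | (p ^ j <= M)%N) (p ^ j)%:R ^- k =
          \sum_(1 <= j < J.+1) q ^- j.
  rewrite (@big_cat_nat _ _ _ J.+1)//= [X in _ + X]big_nat_cond.
  rewrite [X in _ + X]big_pred0 ?addr0; last first.
    move=> j; apply/negP => /andP[/andP[Jj _] /(trunc_log_max p1)].
    by rewrite leqNgt Jj.
  rewrite big_mkcond /=; apply: eq_big_nat => j /andP[_ jJ].
  have -> : (p ^ j <= M)%N.
    apply: leq_trans (trunc_logP p1 M0); rewrite leq_exp2l//.
  by rewrite natrX -exprM mulnC exprM.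
have q0 : 0 < q by lra.
rewrite sum_geometric ?gt_eqF//; try lra.
have E : (q - 1)^-1 - (1 - q ^- J) / (q - 1) = q ^- J.+1 * (q / (q - 1)).
  rewrite exprS; field; rewrite expf_neq0 ?gt_eqF//; lra.
have q1 : 0 < q - 1 by lra.
rewrite E; apply/andP; split.
  by rewrite mulr_ge0// ?divr_ge0 ?invr_ge0 ?exprn_ge0 ?(ltW q0) ?(ltW q1).
rewrite mulrC ler_pM ?divr_ge0 ?invr_ge0 ?exprn_ge0 ?(ltW q0) ?(ltW q1)//.
  by rewrite ler_pdivrMr//; lra.
rewrite lef_pV2 ?posrE ?exprn_gt0 ?ltr0n//.
have -> : q ^+ J.+1 = (p ^ J.+1)%:R ^+ k by rewrite /q -exprM mulnC exprM natrX.
rewrite lerXn2r ?nnegrE// ler_nat ltnW//.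
exact: trunc_log_ltn.
Qed.

(** The partial sums over d <= M and over primes p <= M differ by O(1/M), so they share their limit.
    This evaluates the double sum over p and j without rearranging infinite series. *)
Lemma prime_power_weight_cvg (R : realType) (k : nat) (w : nat -> R) (C : R) :
  (3 <= k)%N ->
  (forall p, prime p -> 0 <= w p <= C * ln p%:R) ->
  cvgn (fun M => \sum_(1 <= d < M.+1) prime_power_weight w d / d%:R ^+ k) ->
  (fun M => \sum_(1 <= d < M.+1) prime_power_weight w d / d%:R ^+ k) @ \oo -->
  \big[+%R/0]_(0 <= p <oo | prime p) (w p / (p%:R ^+ k - 1)).
Proof.
move=> k3 wC; set S := fun M => _ => cvS.
pose A M := \sum_(0 <= p < M | prime p) w p / (p%:R ^+ k - 1).
have C0 : 0 <= C.
  have /andP[w0 wle] := wC 2%N isT.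
  by have := le_trans w0 wle; rewrite pmulr_lge0// ln_gt0// ltr1n.
(* [A] excludes its upper bound while [S] includes it, hence the shift by one; a further shift keeps
   M = n + 1 positive. *)
have diff n : 0 <= A n.+2 - S n.+1 <= 2 * C * n.+1%:R^-1.
  set M := n.+1.
  have M0 : 0 < M%:R :> R by rewrite ltr0n.
  have -> : A M.+1 - S M = \sum_(1 <= p < M.+1 | prime p) w p *
      ((p%:R ^+ k - 1)^-1 -
       \sum_(1 <= j < M.+1 | (p ^ j <= M)%N) (p ^ j)%:R ^- k).
    rewrite /S (sum_prime_power_weight w (fun d => d%:R ^- k)) /A.
    rewrite big_ltn_cond//= -sumrB; apply: eq_bigr => p _.
    by rewrite mulrBr.
  apply/andP; split.
    apply: sumr_ge0 => p pp; have /andP[w0 _] := wC p pp.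
    by rewrite mulr_ge0//; have /andP[] := @prime_power_series_diff R k p M k3 pp isT.
  (* There are at most M primes, each with w(p) <= C ln p <= C M, so the total is at most 2 C
     M^(2-k) <= 2 C / M for k >= 3. *)
  apply: (@le_trans _ _ (\sum_(1 <= p < M.+1) (C * M%:R) * (2 * M%:R ^- k))).
    rewrite big_mkcond /=; apply: ler_sum_nat => p /andP[p0 pM].
    have b0 : 0 <= (C * M%:R) * (2 * M%:R ^- k) :> R.
      by rewrite mulr_ge0 ?mulr_ge0 ?invr_ge0 ?exprn_ge0// ltW.
    case: ifP => // pp; have /andP[w0 wle] := wC p pp.
    have /andP[d0 dle] := @prime_power_series_diff R k p M k3 pp isT.
    apply: ler_pM => //; apply: (le_trans wle); rewrite ler_wpM2l//.
    have pR0 : 0 < p%:R :> R by rewrite ltr0n.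
    by apply: (le_trans (ltW (ln_sublinear pR0))); rewrite ler_nat.
  rewrite sumr_const_nat subn1 /= -[leLHS]mulr_natr.
  have -> : C * M%:R * (2 * M%:R ^- k) * M%:R = 2 * C * (M%:R ^+ 2 * M%:R ^- k).
    by ring.
  rewrite ler_wpM2l ?mulr_ge0// -(subnKC k3) exprD invfM mulrA.
  have -> : M%:R ^+ 2 / M%:R ^+ 3 = M%:R^-1 :> R by field; rewrite gt_eqF.
  rewrite ler_piMr ?invr_ge0 ?(ltW M0)// invf_le1 ?exprn_gt0//.
  by rewrite exprn_ege1// ler1n.
have diff0 : (fun n => A n.+2 - S n.+1) @ \oo --> 0.
  apply: (@squeeze_cvgr _ _ _ _ (fun=> 0) (fun n => 2 * C * harmonic n)).
  - by apply: nearW => n; exact: diff.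
  - exact: cvg_cst.
  - by rewrite -[X in _ --> X](mulr0 (2 * C)); apply: cvgMl_tmp; exact: cvg_harmonic.
have SS : (fun n => S n.+1) @ \oo --> limn S by rewrite (cvg_shiftS S).
have AS2 : (fun n => A n.+2) @ \oo --> limn S.
  have -> : (fun n => A n.+2) = (fun n => A n.+2 - S n.+1) + (fun n => S n.+1).
    by apply/funext => n; rewrite /= /GRing.add /= subrK.
  by rewrite -[limn S]add0r; exact: cvgD.
have AS : A @ \oo --> limn S.
  by rewrite -cvg_shiftS -(cvg_shiftS (fun n => A n.+1)).
by rewrite (_ : \big[_/_]_(0 <= p <oo | _) _ = limn S)//; exact/cvg_lim.
Qed.

(** * The functions log, Omega and omega *)

(** This covers the completely additive functions: w(p) = ln p gives the logarithm and w(p) = 1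
    gives [Omega]. *)
Lemma gcd_sum_prime_power_weight (R : realType) (k : nat) (f w : nat -> R)
    (C : R) (P : {poly R}) (theta : R) :
  (3 <= k)%N -> size P = k -> k%:R^-1 <= theta ->
  (forall n, (0 < n)%N -> f n = \sum_(p <- primes n) (logn p n)%:R * w p) ->
  (forall p, prime p -> 0 < w p <= C * ln p%:R) ->
  (forall eps : R, 0 < eps ->
    (fun x : R => tau_sum k x - x * P.[ln x])
      =O_ (pinfty_nbhs R) (fun x : R => x `^ (theta + eps))) ->
  exists Pf : {poly R},
    [/\ size Pf = k,
        lead_coef Pf = lead_coef P *
          \big[+%R/0]_(0 <= p <oo | prime p) (w p / (p%:R ^+ k - 1))
      & forall eps : R, 0 < eps ->
          (fun x : R => gcd_sum f k x - x * Pf.[ln x])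
            =O_ (pinfty_nbhs R) (fun x : R => x `^ (theta + eps))].
Proof.
move=> k3 sP thk fw wC hO.
have wC' p : prime p -> 0 <= w p <= C * ln p%:R.
  by move=> /wC/andP[/ltW-> ->].
have g0 d : 0 <= prime_power_weight w d.
  by apply: sumr_ge0 => p pp; apply: sumr_ge0 => j _; have /andP[] := wC' p pp.
have fg n : (0 < n)%N ->
    f n = \sum_(1 <= d < n.+1 | (d %| n)%N) prime_power_weight w d.
  by move=> n0; rewrite fw// sum_dvd_prime_power_weight.
have gC d : (0 < d)%N -> 0 <= prime_power_weight w d <= C * ln d%:R.
  (* As d divides itself and the weights are nonnegative, g(d) <= f(d); comparing w(p) with C ln p
     prime by prime gives f(d) <= C ln d. *)
  move=> d0; rewrite g0/=; apply: (@le_trans _ _ (f d)).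
    rewrite fg// big_mkcond big_nat_recr//= dvdnn lerDr.
    by apply: sumr_ge0 => e _; case: ifP.
  rewrite fw// -ln_prime_decomp// mulr_sumr big_seq [leRHS]big_seq.
  apply: ler_sum => p; rewrite mem_primes => /andP[pp _].
  by rewrite mulrCA ler_wpM2l//; have /andP[] := wC' p pp.
have k1 : (1 < k)%N by apply: leq_trans k3.
have gK := prime_power_weight_cvg k3 wC' (dirichlet_cvg k1 gC).
apply: (gcd_sum_asymptotics k3 sP thk fg gC gK) => //.
rewrite gt_eqF//; apply: (dirichlet_gt0 (d0 := 2) _ _ _ gK) => //.
(* The divisor identity at n = 1 and n = 2 gives weight 0 at 1 and weight w(2) > 0 at 2. *)
have w1 := sum_dvd_prime_power_weight w (isT : 0 < 1)%N.
rewrite big_mkcond big_nat1 dvdnn big_nil in w1.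
have := sum_dvd_prime_power_weight w (isT : 0 < 2)%N.
rewrite big_mkcond big_nat_recr//= big_nat1 w1 add0r => ->.
rewrite (_ : primes 2 = [:: 2%N])// big_seq1 (_ : logn 2 2 = 1%N)// mul1r.
by have /andP[] := wC 2%N isT.
Qed.

(** Since [omega] ignores multiplicity, its [g] is the indicator of the primes rather than a prime
    power weight. *)
Lemma gcd_sum_omega (R : realType) (k : nat) (P : {poly R}) (theta : R) :
  (3 <= k)%N -> size P = k -> k%:R^-1 <= theta ->
  (forall eps : R, 0 < eps ->
    (fun x : R => tau_sum k x - x * P.[ln x])
      =O_ (pinfty_nbhs R) (fun x : R => x `^ (theta + eps))) ->
  exists Pf : {poly R},
    [/\ size Pf = k,
        lead_coef Pf = lead_coef P * K_omega R k
      & forall eps : R, 0 < eps ->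
          (fun x : R => gcd_sum (fun n => (omega n)%:R) k x - x * Pf.[ln x])
            =O_ (pinfty_nbhs R) (fun x : R => x `^ (theta + eps))].
Proof.
move=> k3 sP thk hO; pose g (d : nat) : R := (prime d)%:R.
have ln2 : 0 < ln 2 :> R by rewrite ln_gt0// ltr1n.
have fg n : (0 < n)%N ->
    (omega n)%:R = \sum_(1 <= d < n.+1 | (d %| n)%N) g d.
  move=> n0; rewrite /omega -sum1_size natr_sum -sum_prime_dvd//.
  rewrite big_mkcond [RHS]big_mkcond /=; apply: eq_bigr => d _.
  by rewrite /g; case: (prime d) => //; case: ifP.
(* A prime d is at least 2, so 1 <= ln d / ln 2. *)
have gC d : (0 < d)%N -> 0 <= g d <= (ln 2)^-1 * ln d%:R.
  move=> d0; rewrite /g ler0n /=; case: (boolP (prime d)) => [/prime_gt1 d1|_].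
    by rewrite mulrC ler_pdivlMr// mul1r ler_ln ?posrE ?ltr0n// ler_nat.
  by rewrite mulr_ge0 ?invr_ge0 ?ln_ge0 ?ler1n// ltW.
have k1 : (1 < k)%N by apply: leq_trans k3.
have cvS := dirichlet_cvg k1 gC.
have gK : (fun M => \sum_(1 <= d < M.+1) g d / d%:R ^+ k) @ \oo --> K_omega R k.
  rewrite (_ : K_omega R k =
      limn (fun M => \sum_(1 <= d < M.+1) g d / d%:R ^+ k))//.
  apply/cvg_lim => //; rewrite -cvg_shiftS; apply: cvg_trans cvS.
  apply: near_eq_cvg; apply: nearW => M /=.
  rewrite [RHS]big_ltn_cond//= [RHS]big_mkcond /=; apply: eq_bigr => d _.
  by rewrite /g; case: ifP; rewrite ?mul1r ?mul0r.
apply: (gcd_sum_asymptotics k3 sP thk fg gC gK) => //.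
rewrite gt_eqF//; apply: (dirichlet_gt0 (d0 := 2) _ _ _ gK) => //.
Qed.

Theorem theorem2p3 (R : realType) (k : nat) (hk : (3 <= k)%N)
    (f : nat -> R) (K : R)
    (hf : [\/ f = @log_fun R /\ K = K_log R k,
              f = (fun n => (omega n)%:R) /\ K = K_omega R k
            | f = (fun n => (Omega n)%:R) /\ K = K_Omega R k])
    (P : {poly R}) (hP : is_piltz_poly k P)
    (theta : R) (htheta : k%:R^-1 <= theta)
    (hpiltz : forall eps : R, 0 < eps ->
       (fun x : R => tau_sum k x - x * P.[ln x])
         =O_ (pinfty_nbhs R) (fun x : R => x `^ (theta + eps))) :
  exists Pf : {poly R},
    [/\ size Pf = k,
        lead_coef Pf = (k.-1)`!%:R^-1 * K
      & forall eps : R, 0 < eps ->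
          (fun x : R => gcd_sum f k x - x * Pf.[ln x])
            =O_ (pinfty_nbhs R) (fun x : R => x `^ (theta + eps))].
Proof.
case: hP => sP <- _.
have ln2 : 0 < ln 2 :> R by rewrite ln_gt0// ltr1n.
case: hf => -[-> ->].
- apply: (gcd_sum_prime_power_weight (w := fun p => ln p%:R) (C := 1)) => //.
    by move=> n n0; rewrite ln_prime_decomp.
  by move=> p pp; rewrite mul1r lexx ln_gt0// ltr1n prime_gt1.
- exact: gcd_sum_omega.
- rewrite (_ : K_Omega R k =
      \big[+%R/(0 : R)]_(0 <= p <oo | prime p) ((fun=> 1) p / (p%:R ^+ k - 1))).
    apply: (@gcd_sum_prime_power_weight _ _ _ _ (ln 2)^-1) => //.
      move=> n n0; rewrite /Omega natr_sum.
      by apply: eq_bigr => p _; rewrite mulr1.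
    move=> p pp; rewrite ltr01 /= mulrC ler_pdivlMr// mul1r.
    by rewrite ler_ln ?posrE ?ltr0n ?prime_gt0// ler_nat prime_gt1.
  rewrite /K_Omega; congr (limn _); apply/funext => n.
  by apply: eq_bigr => p _; rewrite mul1r.
Qed.
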